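(* Let $K$ be a number field of degree $n$ whose unit group $\mathcal O_K^*$ has rank $r\geq 1$, let $\mathfrak a$ be a nonzero ideal of $\mathcal O_K$, let $B\ge1$ be a real number, fix a system of fundamental units $\boldsymbol\epsilon=\{\epsilon_1,\ldots,\epsilon_r\}$ in $K$, and fix an integral basis $\{\omega_1,\ldots,\omega_n\}$ for $\mathfrak a$. Let $\mathcal H\subset\mathbb R^n$ be the half-space consisting of all points whose first coordinate is non-negative. A complete set of representatives for the orbit space $\mathcal C(\mathfrak a,B)/\{\pm1\}$ is given by all numbers of the form \[x=s_1\omega_1+\cdots+s_n\omega_n\] with $(s_1,\ldots,s_n)\in\mathbb Z^n\cap\mathcal H\cap\mathcal X$ satisfying $\Phi(x)\in\mathcal P(\mathfrak a,B)$ and $|N_{K/\mathbb Q}(x)|\le B\cdot\mathrm N(\mathfrak a)$.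
   Context: $\mathcal O_K$ is the ring of integers of $K$ and $\mathrm N(\mathfrak a)$ denotes the norm of $\mathfrak a$. Let $\sigma_1,\ldots,\sigma_{r_1}$ be the real embeddings of $K$ and $\tau_1,\overline{\tau_1},\ldots,\tau_{r_2},\overline{\tau_{r_2}}$ the pairs of complex conjugate embeddings. Archimedean places $v|\infty$ correspond bijectively to the embeddings $\sigma_1,\ldots,\sigma_{r_1},\tau_1,\ldots,\tau_{r_2}$; for such $v$ put $n_v=1$ (real) or $2$ (complex), $\sigma_v$ for the corresponding embedding, and $\|x\|_v=|\sigma_v(x)|^{n_v}$. Minkowski embedding: $\Phi:K\to\mathbb R^n$, $\Phi(x)=(\sigma_1(x),\ldots,\sigma_{r_1}(x),\Re\tau_1(x),\Im\tau_1(x),\ldots,\Re\tau_{r_2}(x),\Im\tau_{r_2}(x))$. Units: $\Lambda(x)=(\log\|x\|_v)_{v|\infty}$ for $x\in K^*$. A system of fundamental units is a collection $\boldsymbol\epsilon=\{\epsilon_1,\ldots,\epsilon_r\}\subset\mathcal O_K^*$ such that the $\Lambda(\epsilon_j)$ form a basis of the lattice $\Lambda(\mathcal O_K^* )$. Put $F(\boldsymbol\epsilon)=\{\sum_jt_j\Lambda(\epsilon_j):|t_j|\le1/2\text{ for all }j\}$ and $D_v=\max_{\eta\in F(\boldsymbol\epsilon)}\eta_v$; write $D_\sigma=D_v$ if $v$ corresponds to the embedding $\sigma$. Regions, for points $(a_1,\ldots,a_{r_1};x_1,y_1,\ldots,x_{r_2},y_{r_2})\in\mathbb R^n$: $\mathcal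 P(\mathfrak a,B)$ is defined by $|a_i|\le(B\,\mathrm N(\mathfrak a))^{1/n}\exp(D_{\sigma_i})$ and $x_j^2+y_j^2\le(B\,\mathrm N(\mathfrak a))^{2/n}\exp(D_{\tau_j})$ for all $i,j$; $\mathcal P'(\mathfrak a,B)$ is defined by $|a_i|\le(B\,\mathrm N(\mathfrak a))^{1/n}\exp(D_{\sigma_i})$ and $\max\{|x_j|,|y_j|\}\le(B\,\mathrm N(\mathfrak a))^{1/n}\exp(D_{\tau_j}/2)$ for all $i,j$. $\mathcal C(\mathfrak a,B)=\{x\in\mathfrak a:\Phi(x)\in\mathcal P(\mathfrak a,B)\text{ and }|N_{K/\mathbb Q}(x)|\le B\cdot\mathrm N(\mathfrak a)\}$, on which $\{\pm1\}$ acts by multiplication. $S$ is the $n\times n$ matrix with columns $\Phi(\omega_1),\ldots,\Phi(\omega_n)$, and $\mathcal X=S^{-1}(\mathcal P'(\mathfrak a,B))$.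
   Formalization: ''Complete set of representatives'' is proved as: the listed numbers lie in C(a,B), every orbit is represented, and distinct listed coefficient vectors give distinct orbits unless both have s_1 = 0, where x and -x are both listed and uniqueness fails. *)

(* Defs.v *)
From HB Require Import structures.
From mathcomp Require Import all_boot all_order all_algebra all_field finmap.
From mathcomp Require Import complex.
From mathcomp Require Import all_classical all_reals all_analysis.

Set Implicit Arguments.
Unset Strict Implicit.
Unset Printing Implicit Defensive.

Import Order.TTheory GRing.Theory Num.Theory.

Local Open Scope classical_set_scope.
Local Open Scope ring_scope.

(* A number field is a [K : fieldExtType rat]; its degree is [\dim {:K}].     *)

Definition zbasis (V : zmodType) (k : nat) (b : 'I_k -> V) (L : set V) : Prop :=
  let comb (m : 'cV[int]_k) := \sum_j b j *~ m j ord0 in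
  injective comb /\ range comb = L.

Definition ring_of_integers (K : fieldExtType rat) : set K :=
  [set x | integralOver (intr : int -> K) x].
Arguments ring_of_integers : clear implicits.

Definition unit_group (K : fieldExtType rat) : set K :=
  [set u | [/\ u != 0, ring_of_integers K u & ring_of_integers K u^-1]].
Arguments unit_group : clear implicits.

Definition mult_independent (K : fieldExtType rat) (k : nat) (u : 'I_k -> K) :
    Prop :=
  forall m : 'I_k -> int, \prod_j u j ^ m j = 1 -> forall j, m j = 0.

Definition unit_rank (K : fieldExtType rat) (r : nat) : Prop :=
  (exists2 u : 'I_r -> K, forall j, unit_group K (u j) & mult_independent u) /\
  ~ (exists2 u : 'I_r.+1 -> K,
       forall j, unit_group K (u j) & mult_independent u).

Record nonzero_ideal (K : fieldExtType rat) (a : set K) : Prop := NonzeroIdeal {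
  ideal_sub : a `<=` ring_of_integers K;
  ideal0 : a 0;
  idealD : forall x y, a x -> a y -> a (x + y);
  idealM : forall c x, ring_of_integers K c -> a x -> a (c * x);
  ideal_neq0 : exists2 x, a x & x != 0 }.

Definition ideal_cosets (K : fieldExtType rat) (a : set K) : set (set K) :=
  [set [set y | ring_of_integers K y /\ a (y - x)] | x in ring_of_integers K].

(* The index [O_K : a]. *)
Definition ideal_norm (K : fieldExtType rat) (a : set K) : nat :=
  #|` fset_set (ideal_cosets a)|.

(* The determinant of the Q-linear map y |-> x * y.                           *)
Definition field_norm (K : fieldExtType rat) (x : K) : rat :=
  \det (passmx.mxof (vbasis {:K}) (vbasis {:K}) (amull x)).

(* Real embeddings are morphisms to R; an embedding in R[i] is non-real when  *)
(* its image is not contained in R.                                           *)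
Definition nonreal (K : fieldExtType rat) (R : realType) (f : K -> R[i]) :
  Prop := exists x, complex.Im (f x) != 0.

(* [sigma] lists every real embedding once and [tau] contains one member of   *)
(* every pair of complex conjugate embeddings, once.                          *)
Record embeddings (K : fieldExtType rat) (R : realType) (r1 r2 : nat)
    (sigma : 'I_r1 -> {rmorphism K -> R})
    (tau : 'I_r2 -> {rmorphism K -> R[i]}) : Prop := Embeddings {
  real_inj : forall i j, sigma i =1 sigma j -> i = j;
  real_surj : forall f : {rmorphism K -> R}, exists i, f =1 sigma i;
  complex_nonreal : forall j, nonreal (tau j);
  complex_inj : forall i j,
    tau i =1 tau j \/ tau i =1 (fun x => conjc (tau j x)) -> i = j;
  complex_surj : forall f : {rmorphism K -> R[i]}, nonreal f ->
    exists j, f =1 tau j \/ f =1 (fun x => conjc (tau j x)) }.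

(* Archimedean places are elements of ['I_r1 + 'I_r2].                        *)
Definition place_abs (K : fieldExtType rat) (R : realType) (r1 r2 : nat)
    (sigma : 'I_r1 -> {rmorphism K -> R})
    (tau : 'I_r2 -> {rmorphism K -> R[i]}) (v : 'I_r1 + 'I_r2) (x : K) : R :=
  match v with
  | inl i => `|sigma i x|
  | inr j => complex.Re `|tau j x| ^+ 2
  end.

Definition log_emb (K : fieldExtType rat) (R : realType) (r1 r2 : nat)
    (sigma : 'I_r1 -> {rmorphism K -> R})
    (tau : 'I_r2 -> {rmorphism K -> R[i]}) (x : K) :
    {ffun 'I_r1 + 'I_r2 -> R} :=
  [ffun v => ln (place_abs sigma tau v x)].

Definition fundamental_units (K : fieldExtType rat) (R : realType)
    (r1 r2 r : nat) (sigma : 'I_r1 -> {rmorphism K -> R})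
    (tau : 'I_r2 -> {rmorphism K -> R[i]}) (eps : 'I_r -> K) : Prop :=
  (forall j, unit_group K (eps j)) /\
  zbasis (fun j => log_emb sigma tau (eps j))
         (log_emb sigma tau @` unit_group K).

Definition fund_domain (K : fieldExtType rat) (R : realType)
    (r1 r2 r : nat) (sigma : 'I_r1 -> {rmorphism K -> R})
    (tau : 'I_r2 -> {rmorphism K -> R[i]}) (eps : 'I_r -> K) :
    set {ffun 'I_r1 + 'I_r2 -> R} :=
  [set eta | exists2 t : 'I_r -> R, forall j, `|t j| <= 1 / 2 &
     eta = [ffun v => \sum_j t j * log_emb sigma tau (eps j) v]].

(* This supremum is a maximum: see [Dmax_max]. *)
Definition Dmax (K : fieldExtType rat) (R : realType)
    (r1 r2 r : nat) (sigma : 'I_r1 -> {rmorphism K -> R})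
    (tau : 'I_r2 -> {rmorphism K -> R[i]}) (eps : 'I_r -> K)
    (v : 'I_r1 + 'I_r2) : R :=
  sup [set (eta : {ffun 'I_r1 + 'I_r2 -> R}) v
      | eta in fund_domain sigma tau eps].

Lemma Dmax_max (K : fieldExtType rat) (R : realType)
    (r1 r2 r : nat) (sigma : 'I_r1 -> {rmorphism K -> R})
    (tau : 'I_r2 -> {rmorphism K -> R[i]}) (eps : 'I_r -> K)
    (v : 'I_r1 + 'I_r2) :
  (exists2 eta, fund_domain sigma tau eps eta &
     eta v = Dmax sigma tau eps v) /\
  (forall eta, fund_domain sigma tau eps eta ->
     eta v <= Dmax sigma tau eps v).
Proof.
set L := fun j => log_emb sigma tau (eps j) v.
set A := [set (eta : {ffun 'I_r1 + 'I_r2 -> R}) v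
         | eta in fund_domain sigma tau eps].
pose t j : R := Num.sg (L j) / 2.
pose eta0 : {ffun 'I_r1 + 'I_r2 -> R} :=
  [ffun w => \sum_j t j * log_emb sigma tau (eps j) w].
have Feta0 : fund_domain sigma tau eps eta0.
  exists t => // j; rewrite /t normrM normfV (ger0_norm (ler0n R 2))//.
  rewrite ler_pM2r ?invr_gt0 ?ltr0n// normr_sg.
  by rewrite -[1]/(1%:R) ler_nat leq_b1.
have ub0 : ubound A (eta0 v).
  move=> _ [_ [s hs ->] <-]; rewrite !ffunE; apply: ler_sum => j _.
  rewrite -/(L j) (le_trans (ler_norm _))// normrM /t mulrAC -normrEsg mulrC.
  by rewrite ler_wpM2l// -[leRHS]div1r.
have A0 : A (eta0 v) by exists eta0.
have supE : Dmax sigma tau eps v = eta0 v.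
  apply/eqP; rewrite eq_le; apply/andP; split.
    by apply: ge_sup => //; exists (eta0 v).
  by apply: ub_le_sup => //; exists (eta0 v).
split; first by exists eta0.
by move=> eta Feta; rewrite supE; apply: ub0; exists eta.
Qed.

(* R^n is ['cV[R]_(r1 + r2 * 2)]: r1 real coordinates, followed by the rows   *)
(* (Re, Im) of an r2 x 2 matrix read in row-major order.                      *)
Definition minkowski (K : fieldExtType rat) (R : realType) (r1 r2 : nat)
    (sigma : 'I_r1 -> {rmorphism K -> R})
    (tau : 'I_r2 -> {rmorphism K -> R[i]}) (x : K) : 'cV[R]_(r1 + r2 * 2) :=
  col_mx (\col_i sigma i x)
    (mxvec (\matrix_(j < r2, k < 2)
       if k == ord0 then complex.Re (tau j x) else complex.Im (tau j x)))^T.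

Definition coord_a (R : realType) (r1 r2 : nat) (p : 'cV[R]_(r1 + r2 * 2))
    (i : 'I_r1) : R := usubmx p i ord0.

Definition coord_x (R : realType) (r1 r2 : nat) (p : 'cV[R]_(r1 + r2 * 2))
    (j : 'I_r2) : R := vec_mx (dsubmx p)^T j ord0.

Definition coord_y (R : realType) (r1 r2 : nat) (p : 'cV[R]_(r1 + r2 * 2))
    (j : 'I_r2) : R := vec_mx (dsubmx p)^T j ord_max.

(* [c] stands for B * N(a), and [D] for the family D_v.                       *)
Definition region_P (R : realType) (r1 r2 : nat) (D : 'I_r1 + 'I_r2 -> R)
    (c : R) : set 'cV[R]_(r1 + r2 * 2) :=
  let n := (r1 + r2 * 2)%N in
  [set p | (forall i, `|coord_a p i| <= c `^ n%:R^-1 * expR (D (inl i))) /\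
     (forall j, coord_x p j ^+ 2 + coord_y p j ^+ 2
                <= c `^ (2 / n%:R) * expR (D (inr j)))].

Definition region_P' (R : realType) (r1 r2 : nat) (D : 'I_r1 + 'I_r2 -> R)
    (c : R) : set 'cV[R]_(r1 + r2 * 2) :=
  let n := (r1 + r2 * 2)%N in
  [set p | (forall i, `|coord_a p i| <= c `^ n%:R^-1 * expR (D (inl i))) /\
     (forall j, Num.max `|coord_x p j| `|coord_y p j|
                <= c `^ n%:R^-1 * expR (D (inr j) / 2))].

Definition norm_le (K : fieldExtType rat) (R : realType) (x : K) (c : R) :
  Prop := `|ratr (field_norm x) : R| <= c.

Definition setC_aB (K : fieldExtType rat) (R : realType) (r1 r2 r : nat)
    (sigma : 'I_r1 -> {rmorphism K -> R})
    (tau : 'I_r2 -> {rmorphism K -> R[i]}) (eps : 'I_r -> K)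
    (a : set K) (B : R) : set K :=
  let c := B * (ideal_norm a)%:R in
  [set x | [/\ a x,
     region_P (Dmax sigma tau eps) c (minkowski sigma tau x) & norm_le x c]].

(* Orbits for the action of {1, -1} by multiplication. *)
Definition pm_orbit (K : fieldExtType rat) (x : K) : set K := [set x; - x].

Definition basis_matrix (K : fieldExtType rat) (R : realType) (r1 r2 : nat)
    (sigma : 'I_r1 -> {rmorphism K -> R})
    (tau : 'I_r2 -> {rmorphism K -> R[i]})
    (omega : 'I_(r1 + r2 * 2) -> K) : 'M[R]_(r1 + r2 * 2) :=
  \matrix_(i, j) minkowski sigma tau (omega j) i ord0.

Definition setX_aB (K : fieldExtType rat) (R : realType) (r1 r2 r : nat)
    (sigma : 'I_r1 -> {rmorphism K -> R})
    (tau : 'I_r2 -> {rmorphism K -> R[i]}) (eps : 'I_r -> K)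
    (a : set K) (B : R) (omega : 'I_(r1 + r2 * 2) -> K) :
    set 'cV[R]_(r1 + r2 * 2) :=
  [set invmx (basis_matrix sigma tau omega) *m p
  | p in region_P' (Dmax sigma tau eps) (B * (ideal_norm a)%:R)].

(* Stated for every index of value 0, as n is not syntactically a successor.  *)
Definition half_space (R : realType) (n : nat) : set 'cV[R]_n :=
  [set p | forall i : 'I_n, val i = 0%N -> 0 <= p i ord0].

Definition int_comb (K : fieldExtType rat) (n : nat) (omega : 'I_n -> K)
  (s : 'cV[int]_n) : K := \sum_i omega i *~ s i ord0.

Definition admissible (K : fieldExtType rat) (R : realType) (r1 r2 r : nat)
    (sigma : 'I_r1 -> {rmorphism K -> R})
    (tau : 'I_r2 -> {rmorphism K -> R[i]}) (eps : 'I_r -> K)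
    (a : set K) (B : R) (omega : 'I_(r1 + r2 * 2) -> K) :
    set 'cV[int]_(r1 + r2 * 2) :=
  let c := B * (ideal_norm a)%:R in
  [set s | [/\ (@half_space R _ `&` setX_aB sigma tau eps a B omega)
                 (map_mx intr s),
     region_P (Dmax sigma tau eps) c (minkowski sigma tau (int_comb omega s)) &
     norm_le (int_comb omega s) c]].

(* Main.v *)
Require Import Defs.
From HB Require Import structures.
From mathcomp Require Import all_boot all_order all_algebra all_field.
From mathcomp Require Import complex.
From mathcomp Require Import all_classical all_reals all_analysis.
From mathcomp Require Import ring.
Import Order.TTheory GRing.Theory Num.Theory.
Import passmx.
Local Open Scope classical_set_scope.
Local Open Scope ring_scope.

(** The representatives come from the coordinates [s = S^-1 Phi(x)] of an
    element [x] of the ideal in its integral basis.  Since [P] lies inside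
    [P'], an [x] with [Phi(x)] in [P] has its coordinate vector in
    [X = S^-1 P'] (lemma [setX_int_comb]), so the condition [s \in X] holds for
    every element of [C]; and one of [s], [-s] lies in the half-space.
    Conversely two representatives with the same orbit are equal or opposite,
    and opposite vectors in the half-space have first coordinate [0]: these
    are the only orbits that can be met twice.

    The substance is that [S] is invertible (lemma [basis_matrix_unit]).  A
    row vector [v] with [v S = 0] gives a functional [x |-> v Phi(x)] killing
    the [omega_j].  These are independent over the integers, hence over the
    rationals, and there are as many of them as the degree, so they span [K]
    (lemma [zindependent_basis]) and the functional is zero on [K].  Extended
    to complex coefficients, it is a linear relation between the [sigma_i], the
    [tau_j] and their conjugates, which are pairwise distinct; Dedekind's
    theorem on independence of characters ([character_independence]) makes
    all its coefficients vanish. *)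

(** * Independence of characters *)

(** If [c i0 <> 0], some other coefficient [c i1] is nonzero, as evaluation
    at [1] shows.  Choosing [y] with [f i0 y <> f i1 y], the relation at [x y]
    minus [f i1 y] times the relation at [x] no longer involves [f i1], still
    involves [f i0], and has smaller support. *)
Lemma character_independence (A : pzSemiRingType) (F : idomainType)
    (I : finType) (f : I -> A -> F) (c : I -> F) :
    (forall i, f i 1 = 1) ->
    (forall i x y, f i (x * y) = f i x * f i y) ->
    (forall i j, f i =1 f j -> i = j) ->
    (forall x, \sum_i c i * f i x = 0) ->
  forall i, c i = 0.
Proof.
move=> f1 fM finj.
have [n] := ubnP #|[pred i | c i != 0]|; elim: n c => // n IHn c.
rewrite ltnS => le_n rel i0; apply: contrapT => /eqP ci0.
have [i1 ci1 i10] : exists2 i1, c i1 != 0 & i1 != i0.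
  apply: contrapT => no_i1.
  have := rel 1; rewrite (bigD1 i0)//= big1 => [|i ii0].
    by rewrite f1 mulr1 addr0 => /eqP; apply/negP.
  have [->|ci] := eqVneq (c i) 0; first by rewrite mul0r.
  by case: no_i1; exists i.
have [y fy] : exists y, f i0 y <> f i1 y.
  by apply/existsNP => eq_f; move: i10; rewrite (finj _ _ eq_f) eqxx.
pose d i := c i * (f i y - f i1 y).
have d0 : d i0 = 0.
  apply: (IHn d) => [|x].
    apply: leq_trans le_n; apply: proper_card; apply/fintype.properP; split.
      apply/fintype.subsetP => i; rewrite !inE /d.
      by apply: contraNneq => ->; rewrite mul0r.
    by exists i1; rewrite !inE ?ci1// /d subrr mulr0 eqxx.
  transitivity (\sum_i c i * f i (x * y) - (\sum_i c i * f i x) * f i1 y).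
    rewrite mulr_suml -sumrB; apply: eq_bigr => i _.
    by rewrite fM /d mulrBr mulrBl !mulrA; congr (_ - _); rewrite mulrAC.
  by rewrite !rel mul0r subrr.
move/eqP: d0; rewrite /d mulf_eq0 (negPf ci0)/= subr_eq0 => /eqP.
exact: fy.
Qed.

(** * Integral bases are rational bases *)

Lemma common_denominator (n : nat) (q : 'I_n -> rat) :
  exists (N : int) (m : 'I_n -> int),
    N != 0 /\ forall i, N%:~R * q i = (m i)%:~R.
Proof.
exists (\prod_i denq (q i)).
exists (fun i => numq (q i) * \prod_(j | j != i) denq (q j)); split.
  by apply/prodf_neq0 => i _; exact: denq_neq0.
move=> i; rewrite (bigD1 i)//= !intrM mulrAC; congr (_ * _).
by rewrite numqE mulrC.
Qed.

Lemma int_combE (K : fieldExtType rat) (n : nat) (w : 'I_n -> K)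
    (s : 'cV[int]_n) :
  int_comb w s = \sum_i (s i ord0)%:~R *: w i.
Proof. by rewrite /int_comb; apply: eq_bigr => i _; rewrite scaler_int. Qed.

Lemma zindependent_basis (K : fieldExtType rat) (n : nat) (w : 'I_n -> K) :
    \dim {:K} = n -> injective (int_comb w) ->
  basis_of fullv (mktuple w).
Proof.
move=> dimK inj.
have freew : free (mktuple w).
  apply/freeP => k rel i; have [N [m [N0 km]]] := common_denominator _ k.
  have m0 : \col_j m j = 0 :> 'cV[int]_n.
    apply: inj; rewrite !int_combE [RHS]big1 => [|j _]; last first.
      by rewrite mxE scale0r.
    transitivity ((N%:~R : rat) *: \sum_j k j *: (mktuple w)`_j); last first.
      by rewrite rel scaler0.
    rewrite scaler_sumr; apply: eq_bigr => j _.
    by rewrite mxE -km -tnth_nth tnth_mktuple scalerA.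
  have /eqP := km i; have := congr1 (fun u : 'cV_n => u i ord0) m0.
  by rewrite !mxE => ->; rewrite mulf_eq0 intr_eq0 (negPf N0) => /eqP.
by rewrite basisEfree freew subvf size_tuple dimK leqnn.
Qed.

(** A torsion-free target makes the additive [g] vanish on the rational span as
    soon as it vanishes on the integral one. *)
Lemma additive_eq0_basis (K : fieldExtType rat) (R : numDomainType) (n : nat)
    (w : 'I_n -> K) (g : {additive K -> R}) :
    basis_of fullv (mktuple w) ->
    (forall i, g (w i) = 0) ->
  forall x, g x = 0.
Proof.
move=> bw gw x; rewrite (coord_basis bw (memvf x)) raddf_sum big1// => i _.
rewrite -tnth_nth tnth_mktuple; set q := coord _ _ _.
have : g (q *: w i) *~ denq q = g (w i) *~ numq q.
  rewrite -[LHS]raddfMz -[RHS]raddfMz; congr (g _).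
  by rewrite -[LHS](@scaler_int rat) -[RHS](@scaler_int rat) scalerA mulrC -numqE.
rewrite gw mul0rz => /eqP; rewrite mulrz_eq0 (negPf (denq_neq0 q)) /=.
by move/eqP.
Qed.

(** * Invertibility of the basis matrix *)

Lemma mxvec_pairing (R : comPzRingType) (m n : nat) (A B : 'M[R]_(m, n)) :
  (mxvec A *m (mxvec B)^T) ord0 ord0 = \sum_i \sum_j A i j * B i j.
Proof.
rewrite mxE (reindex _ (curry_mxvec_bij _ _))/= pair_bigA/=.
by apply: eq_bigr => -[i j] _; rewrite /= !mxE !mxvecE.
Qed.

Section Minkowski.
Context (K : fieldExtType rat) (R : realType) (r1 r2 : nat).
Context (sigma : 'I_r1 -> {rmorphism K -> R}).
Context (tau : 'I_r2 -> {rmorphism K -> R[i]}).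
Local Notation n := (r1 + r2 * 2)%N.
Local Notation Phi := (Defs.minkowski sigma tau).
Local Notation S := (basis_matrix sigma tau).

Lemma coord_a_minkowski x i : coord_a (Phi x) i = sigma i x.
Proof. by rewrite /coord_a col_mxKu mxE. Qed.

Lemma coord_x_minkowski x j : coord_x (Phi x) j = complex.Re (tau j x).
Proof. by rewrite /coord_x col_mxKd trmxK mxvecK mxE. Qed.

Lemma coord_y_minkowski x j : coord_y (Phi x) j = complex.Im (tau j x).
Proof. by rewrite /coord_y col_mxKd trmxK mxvecK mxE. Qed.

Lemma minkowski_is_zmod_morphism : zmod_morphism Phi.
Proof.
move=> x y; rewrite /Defs.minkowski opp_col_mx add_col_mx; congr col_mx.
  by apply/colP => i; rewrite !mxE rmorphB.
rewrite -[RHS]raddfB/= -[in RHS]raddfB/=; congr (mxvec _)^T.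
by apply/matrixP => j k; rewrite !mxE rmorphB; case: ifP; rewrite raddfB.
Qed.

HB.instance Definition _ :=
  GRing.isZmodMorphism.Build K 'cV[R]_n Phi minkowski_is_zmod_morphism.

Lemma minkowski_int_comb (omega : 'I_n -> K) s :
  Phi (int_comb omega s) = S omega *m map_mx intr s.
Proof.
rewrite /int_comb raddf_sum; apply/colP => i; rewrite summxE mxE.
apply: eq_bigr => j _; rewrite raddfMz -scaler_int.
by rewrite [LHS]mxE mulrC; congr (_ * _); rewrite [RHS]mxE.
Qed.

Lemma pairing_minkowski (v : 'rV[R]_n) x :
  (v *m Phi x) ord0 ord0 =
    \sum_i lsubmx v ord0 i * sigma i x
    + \sum_j (vec_mx (rsubmx v) j ord0 * complex.Re (tau j x)
              + vec_mx (rsubmx v) j ord_max * complex.Im (tau j x)).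
Proof.
rewrite -[in LHS](hsubmxK v) mul_row_col mxE; congr (_ + _).
  by rewrite mxE; apply: eq_bigr => i _; rewrite [in X in _ * X]mxE.
rewrite -[in LHS](vec_mxK (rsubmx v)) mxvec_pairing; apply: eq_bigr => j _.
rewrite big_ord_recl big_ord1.
have -> : lift ord0 ord0 = ord_max :> 'I_2 by apply: val_inj.
by rewrite !mxE.
Qed.

(** All values are in [R[i]], so that real and nonreal embeddings are
    characters to one field; the index counts conjugates separately. *)
Definition embedding (v : 'I_r1 + ('I_r2 + 'I_r2)) (x : K) : R[i] :=
  match v with
  | inl i => (sigma i x)%:C%C
  | inr (inl j) => tau j x
  | inr (inr j) => conjc (tau j x)
  end.

Hypothesis emb : embeddings sigma tau.

Lemma tau_neq_conj j : ~ (forall x, tau j x = conjc (tau j x)).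
Proof.
move=> h; have [x /negP[]] := complex_nonreal emb j.
by move: (h x); case: (tau j x) => u w [] /eqP; rewrite -addr_eq0 -mulr2n
  mulrn_eq0.
Qed.

Lemma embedding_inj v w : embedding v =1 embedding w -> v = w.
Proof.
have real_nonreal i j : ~ (forall x, (sigma i x)%:C%C = tau j x).
  by move=> h; apply: (@tau_neq_conj j) => x; rewrite -h conjc_real.
have real_nonrealJ i j : ~ (forall x, (sigma i x)%:C%C = conjc (tau j x)).
  by move=> h; apply: (@real_nonreal i j) => x; rewrite -conjc_real h conjcK.
have nonreal_conj j k : ~ (forall x, tau j x = conjc (tau k x)).
  move=> h; have jk : j = k by apply: (complex_inj emb); right.
  by apply: (@tau_neq_conj j) => x; rewrite {2}jk.
case: v w => [i|[j|j]] [i'|[j'|j']] /= h.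
- by congr inl; apply: (real_inj emb) => x; have [] := h x.
- by case: (real_nonreal _ _ h).
- by case: (real_nonrealJ _ _ h).
- by case: (real_nonreal i' j) => x; exact: esym (h x).
- by congr (inr (inl _)); apply: (complex_inj emb); left.
- by case: (nonreal_conj _ _ h).
- by case: (real_nonrealJ i' j) => x; exact: esym (h x).
- by case: (nonreal_conj j' j) => x; exact: esym (h x).
- congr (inr (inr _)); apply: (complex_inj emb); left => x.
  by apply: (can_inj (@conjcK R)); exact: h.
Qed.

(** With [Re t = (t + t^-) / 2] and [Im t = (t^- - t) i / 2], the real relation
    [a Re t + b Im t] has coefficient [(a - b i) / 2] at [t] and the conjugate
    at [t^-]. *)
Lemma minkowski_independence (v : 'rV[R]_n) :
  (forall x, (v *m Phi x) ord0 ord0 = 0) -> v = 0.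
Proof.
move=> v0; pose V := vec_mx (rsubmx v).
pose c (w : 'I_r1 + ('I_r2 + 'I_r2)) : R[i] := match w with
  | inl i => (lsubmx v ord0 i)%:C%C
  | inr (inl j) => Complex (V j ord0 / 2) (- (V j ord_max / 2))
  | inr (inr j) => Complex (V j ord0 / 2) (V j ord_max / 2)
  end.
have c0 : forall w, c w = 0.
  apply: (character_independence _ _ _ embedding).
  - by case=> [i|[j|j]] /=; rewrite !rmorph1.
  - by case=> [i|[j|j]] x y /=; rewrite !rmorphM.
  - exact: embedding_inj.
  move=> x; rewrite !big_sumType/= -big_split/=.
  transitivity (((v *m Phi x) ord0 ord0)%:C%C); last by rewrite v0.
  rewrite pairing_minkowski rmorphD !rmorph_sum/=; congr (_ + _).
    by apply: eq_bigr => i _; rewrite -rmorphM.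
  apply: eq_bigr => j _; rewrite -/V; case: (tau j x) => p q /=.
  by apply/eqP; rewrite eq_complex/=; apply/andP; split; apply/eqP; field.
rewrite -(hsubmxK v) -(vec_mxK (rsubmx v)) -/V.
have -> : lsubmx v = 0.
  by apply/rowP => i; have [->] := c0 (inl i); rewrite mxE.
have -> : V = 0.
  apply/matrixP => j k; have [/eqP] := c0 (inr (inr j)).
  rewrite !mulf_eq0 invr_eq0 pnatr_eq0 !orbF => /eqP V0 /eqP.
  rewrite !mulf_eq0 invr_eq0 pnatr_eq0 !orbF => /eqP V1.
  rewrite [RHS]mxE; have [->//|k0] := eqVneq k ord0.
  by rewrite -V1; congr (V j _); apply: val_inj; case: k k0 => [[|[|]]].
by rewrite linear0 row_mx0.
Qed.

Lemma basis_matrix_unit (omega : 'I_n -> K) :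
  \dim {:K} = n -> injective (int_comb omega) -> S omega \in unitmx.
Proof.
move=> degK inj; rewrite -row_free_unit; apply: inj_row_free => v vS.
apply: minkowski_independence.
pose g x := (v *m Phi x) ord0 ord0.
have gB : zmod_morphism g.
  by move=> x y; rewrite /g raddfB mulmxBr !mxE.
pose gA : {additive K -> R} :=
  HB.pack g (GRing.isZmodMorphism.Build K R g gB).
apply: (@additive_eq0_basis _ _ _ omega gA) => [|j].
  exact: zindependent_basis.
rewrite /= /g; have -> : Phi (omega j) = col j (S omega).
  by apply/colP => i; rewrite !mxE.
by rewrite colE mulmxA vS mul0mx mxE.
Qed.

End Minkowski.

(** * The regions P and P' *)

(** The bound on [|x_j|] in [P'] is the square root of the one on
    [x_j^2 + y_j^2] in [P]. *)
Lemma region_P_sub (R : realType) (r1 r2 : nat) (D : 'I_r1 + 'I_r2 -> R)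
    (c : R) :
  region_P D c `<=` region_P' D c.
Proof.
move=> p [pa pxy]; split=> // j.
set b := c `^ _ * _.
have b0 : 0 <= b by rewrite mulr_ge0 ?powR_ge0 ?expR_ge0.
have b2 : c `^ (2 / (r1 + r2 * 2)%:R) * expR (D (inr j)) = b ^+ 2.
  rewrite /b exprMn mulrC [2 / _]mulrC powRrM powR_mulrn ?powR_ge0// mulrC.
  by rewrite -expRM_natr divfK// pnatr_eq0.
have := pxy j; rewrite b2 => xy.
have sqr_le (z : R) : z ^+ 2 <= b ^+ 2 -> `|z| <= b.
  by rewrite -real_normK ?num_real// ler_pXn2r ?nnegrE.
by rewrite ge_max !sqr_le// (le_trans _ xy)// ?lerDl ?lerDr sqr_ge0.
Qed.

Lemma region_PN (K : fieldExtType rat) (R : realType) (r1 r2 : nat)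
    (sigma : 'I_r1 -> {rmorphism K -> R})
    (tau : 'I_r2 -> {rmorphism K -> R[i]}) (D : 'I_r1 + 'I_r2 -> R) (c : R)
    (x : K) :
  region_P D c (Defs.minkowski sigma tau x) ->
  region_P D c (Defs.minkowski sigma tau (- x)).
Proof.
move=> [pa pxy]; split=> [i|j].
  by have := pa i; rewrite !coord_a_minkowski rmorphN normrN.
have := pxy j; rewrite !coord_x_minkowski !coord_y_minkowski rmorphN !raddfN.
by rewrite !sqrrN.
Qed.

Lemma norm_leN (K : fieldExtType rat) (R : realType) (x : K) (c : R) :
  norm_le x c -> norm_le (- x) c.
Proof.
have normN : field_norm (- x) = (-1) ^+ \dim {:K} * field_norm x.
  by rewrite /field_norm !raddfN -scaleN1r detZ.
rewrite /norm_le normN rmorphM rmorph_sign [in X in _ -> X]normrM.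
by rewrite normrX normrN1 expr1n mul1r.
Qed.

(** * Representatives of the orbits *)

Lemma setX_int_comb (K : fieldExtType rat) (R : realType) (r1 r2 r : nat)
    (sigma : 'I_r1 -> {rmorphism K -> R})
    (tau : 'I_r2 -> {rmorphism K -> R[i]}) (eps : 'I_r -> K) (a : set K)
    (B : R) (omega : 'I_(r1 + r2 * 2) -> K) (s : 'cV[int]_(r1 + r2 * 2)) :
    basis_matrix sigma tau omega \in unitmx ->
    region_P (Dmax sigma tau eps) (B * (ideal_norm a)%:R)
      (Defs.minkowski sigma tau (int_comb omega s)) ->
  setX_aB sigma tau eps a B omega (map_mx intr s).
Proof.
move=> Su Ps; exists (Defs.minkowski sigma tau (int_comb omega s)).
  exact: region_P_sub.
by rewrite minkowski_int_comb mulKmx.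
Qed.

Lemma int_combN (K : fieldExtType rat) (n : nat) (w : 'I_n -> K) s :
  int_comb w (- s) = - int_comb w s.
Proof.
by rewrite /int_comb -sumrN; apply: eq_bigr => i _; rewrite mxE mulrNz.
Qed.

Lemma pm_orbitN (K : fieldExtType rat) (x : K) : pm_orbit (- x) = pm_orbit x.
Proof. by rewrite /pm_orbit opprK setUC. Qed.

Lemma half_space_or_opp (R : realType) (n : nat) (s : 'cV[int]_n) :
  @half_space R n (map_mx intr s) \/ @half_space R n (map_mx intr (- s)).
Proof.
have [[i i0 si]|nneg] := pselect (exists2 i : 'I_n, val i = 0%N & s i ord0 < 0).
  right=> j j0; have -> : j = i by apply: val_inj; rewrite /= j0.
  by rewrite !mxE ler0z oppr_ge0 ltW.
left=> j j0; rewrite mxE ler0z leNgt; apply/negP => sj.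
by apply: nneg; exists j.
Qed.

Theorem proposition3p8 (K : fieldExtType rat) (R : realType) (r1 r2 r : nat)
    (sigma : 'I_r1 -> {rmorphism K -> R})
    (tau : 'I_r2 -> {rmorphism K -> R[i]})
    (degK : \dim {:K} = (r1 + r2 * 2)%N)
    (emb : embeddings sigma tau)
    (rankK : unit_rank K r) (r_ge1 : (1 <= r)%N)
    (a : set K) (ideal_a : nonzero_ideal a)
    (B : R) (B_ge1 : 1 <= B)
    (eps : 'I_r -> K) (fund : fundamental_units sigma tau eps)
    (omega : 'I_(r1 + r2 * 2) -> K) (basis : zbasis omega a) :
  let C := setC_aB sigma tau eps a B in
  let A := admissible sigma tau eps a B omega in
  let reps := [set int_comb omega s | s in A] in
  [/\ reps `<=` C,
      @pm_orbit K @` reps = @pm_orbit K @` C &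
      forall s s', A s -> A s' ->
        pm_orbit (int_comb omega s) = pm_orbit (int_comb omega s') ->
        s = s' \/ (forall i : 'I_(r1 + r2 * 2), val i = 0%N -> s i ord0 = 0)].
Proof.
move=> C A reps.
case: basis => inj rng.
have Su := basis_matrix_unit _ _ _ _ _ _ emb _ degK inj.
have repsC : reps `<=` C.
  by move=> _ [s [_ Ps Ns] <-]; split=> //; rewrite -rng; exists s.
split=> //.
- apply/seteqP; split=> [_ [x repx <-]|_ [x [ax Px Nx] <-]].
    by exists x => //; apply: repsC.
  have [s _ xE] : range (int_comb omega) x by rewrite /int_comb rng.
  subst x; case: (half_space_or_opp R _ s) => Hs.
    exists (int_comb omega s) => //; exists s => //; split=> //; split=> //.
    exact: setX_int_comb.
  exists (int_comb omega (- s)); last by rewrite int_combN pm_orbitN.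
  have PN := region_PN _ _ _ _ _ _ _ _ _ Px; have NN := norm_leN _ _ _ _ Nx.
  exists (- s) => //; rewrite -int_combN in PN NN; split=> //; split=> //.
  exact: setX_int_comb.
- move=> s s' [[Hs _] _ _] [[Hs' _] _ _] eq_orb.
  have : pm_orbit (int_comb omega s') (int_comb omega s).
    by rewrite -eq_orb; left.
  case=> [/inj|]; first by left.
  rewrite -int_combN => /inj ss'; right=> i i0.
  have := Hs i i0; have := Hs' i i0; rewrite ss' !mxE !ler0z => si' nsi'.
  by apply/eqP; rewrite eq_le nsi' oppr_le0 si'.
Qed.
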